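(* Let $q$ be a prime power, and let $C\subseteq\mathbb{F}_{q}((t))$ be any subfield. Let $\alpha$ be an existential $\mathcal{L}_{\mathrm{val}}$-formula with parameters from $C$. Then there exists an existential $\mathcal{L}_{\mathrm{ring}}$-formula $\beta$ with parameters in $C$ such that $\alpha$ and $\beta$ are equivalent modulo the theory of $\mathbb{F}_{q}((t))$.
   Context: $\mathcal{L}_{\mathrm{ring}}$ is the first-order language of rings, and $\mathcal{L}_{\mathrm{val}}:=\mathcal{L}_{\mathrm{ring}}\cup\{\mathcal{O}\}$ is the language of valued fields, where $\mathcal{O}$ is a unary predicate symbol. The field $\mathbb{F}_{q}((t))$ of formal Laurent series over the finite field $\mathbb{F}_{q}$ is regarded as an $\mathcal{L}_{\mathrm{val}}$-structure by interpreting $\mathcal{O}$ as the valuation ring $\mathbb{F}_{q}[[t]]$ of the $t$-adic valuation. Equivalence modulo the theory of $\mathbb{F}_{q}((t))$ refers to the complete theory of this structure with constants naming the elements of $C$; i.e. $\alpha$ and $\beta$ have the same free variables and define the same set in $\mathbb{F}_{q}((t))$. *)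

(* Defs.v *)
From HB Require Import structures.
From mathcomp Require Import all_boot all_order all_algebra.
From mathcomp Require Import boolp classical_sets functions cardinality fsbigop.

Set Implicit Arguments.
Unset Strict Implicit.
Unset Printing Implicit Defensive.

Import Order.TTheory GRing.Theory Num.Theory.

Local Open Scope ring_scope.

(* The series \sum_i (f i) t^i, given by its family of coefficients. *)
Record laurent (F : fieldType) := Laurent {
  lcoef :> int -> F;
  lcoefP : exists m : int, forall i, i < m -> lcoef i = 0 }.

HB.instance Definition _ (F : fieldType) := gen_eqMixin (laurent F).
HB.instance Definition _ (F : fieldType) := gen_choiceMixin (laurent F).

Section LaurentField.
Variable F : fieldType.
Implicit Types (f g h : laurent F) (u v w : nat -> F) (a b m : int) (n : nat).

Lemma laurentP f g : f =1 g -> f = g.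
Proof.
case: f g => [f fP] [g gP] /= /funext fg; move: fP gP.
rewrite fg => fP gP; congr Laurent; exact: Prop_irrelevance.
Qed.

Fact zero_subproof : exists m, forall i, i < m -> (fun=> 0 : F) i = 0.
Proof. by exists 0. Qed.
Definition lzero := Laurent zero_subproof.

Fact one_subproof : exists m, forall i, i < m -> (i == 0)%:R = 0 :> F.
Proof. by exists 0 => i i0; rewrite lt_eqF. Qed.
Definition lone := Laurent one_subproof.

Fact opp_subproof f : exists m, forall i, i < m -> - f i = 0.
Proof.
by case: (lcoefP f) => m fm; exists m => i im; rewrite fm// oppr0.
Qed.
Definition lopp f := Laurent (opp_subproof f).

Fact add_subproof f g : exists m, forall i, i < m -> f i + g i = 0.
Proof.
case: (lcoefP f) (lcoefP g) => a fa [b gb].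
by exists (Num.min a b) => i; rewrite lt_min => /andP[? ?]; rewrite fa// gb// addr0.
Qed.
Definition ladd f g := Laurent (add_subproof f g).

(* A sum over a finite support, since f and g vanish in low degrees. *)
Definition lmul_coef f g (k : int) : F :=
  \sum_(i \in [set: int]) f i * g (k - i).

Lemma lmul_coef0 f g a b k : (forall i, i < a -> f i = 0) ->
  (forall i, i < b -> g i = 0) -> k < a + b -> lmul_coef f g k = 0.
Proof.
move=> fa gb kab; apply: fsbig1 => i _.
have [ia|ai] := ltP i a; first by rewrite fa// mul0r.
by rewrite gb ?mulr0// ltrBlDr (lt_le_trans kab)// addrC lerD2l.
Qed.

Lemma lmul_coefE f g a b n : (forall i, i < a -> f i = 0) ->
  (forall i, i < b -> g i = 0) ->
  lmul_coef f g (a + b + n%:Z) =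
    \sum_(i < n.+1) f (a + i%:Z) * g (b + (n - i)%N%:Z).
Proof.
move=> fa gb; pose s := [seq a + i%:Z | i <- iota 0 n.+1].
have s_uniq : uniq s by rewrite map_inj_uniq ?iota_uniq// => i j /addrI [].
rewrite /lmul_coef (@fsbigE _ _ _ _ _ s) //=.
- rewrite big_mkcond /s big_map -[iota _ _]/(index_iota 0 n.+1) big_mkord.
  apply: eq_bigr => i _; rewrite in_setT; congr (_ * g _).
  by rewrite -subzn ?leq_ord// opprD addrACA [a + b]addrC addrK.
- move=> i _ is_; have [ia|ai] := ltP i a; first by rewrite fa// mul0r.
  rewrite gb ?mulr0//; move: is_; rewrite -(subrKC a i).
  have : 0 <= i - a by rewrite subr_ge0.
  case: (i - a) => // j _; rewrite /s (mem_map (f := fun i : nat => a + i%:Z)); last by move=> x y /addrI [].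
  rewrite mem_iota add0n ltnNge negbK => nj.
  rewrite ltrBlDr addrA [b + a]addrC ltrD2l ltz_nat.
  exact: nj.
Qed.

Fact mul_subproof f g : exists m, forall k, k < m -> lmul_coef f g k = 0.
Proof.
case: (lcoefP f) (lcoefP g) => a fa [b gb].
by exists (a + b) => k; exact: lmul_coef0.
Qed.
Definition lmul f g := Laurent (mul_subproof f g).

Let lshift_coef a u (i : int) : F := if i - a is Posz n then u n else 0.

Fact lshift_subproof a u : exists m, forall i, i < m -> lshift_coef a u i = 0.
Proof.
exists a => i; rewrite /lshift_coef -subr_lt0.
by case: (i - a).
Qed.
(* t^a * \sum_n (u n) t^n *)
Definition lshift a u := Laurent (lshift_subproof a u).

Lemma lshiftE a u n : lshift a u (a + n%:Z) = u n.
Proof. by rewrite /= /lshift_coef addrAC subrr add0r. Qed.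

Lemma lshift_lt a u i : i < a -> lshift a u i = 0.
Proof. by rewrite /= /lshift_coef -subr_lt0; case: (i - a). Qed.

Lemma lshift_eq f a u : (forall i, i < a -> f i = 0) ->
  (forall n, f (a + n%:Z) = u n) -> f = lshift a u.
Proof.
move=> fa fu; apply: laurentP => i.
have [ia|ai] := ltP i a; first by rewrite fa// lshift_lt.
rewrite -(subrKC a i); have : 0 <= i - a by rewrite subr_ge0.
by case: (i - a) => // n _; rewrite fu lshiftE.
Qed.

Lemma lshiftK f a : (forall i, i < a -> f i = 0) ->
  f = lshift a (fun n => f (a + n%:Z)).
Proof. by move=> fa; apply: lshift_eq. Qed.

Lemma lshift_ext a u v : u =1 v -> lshift a u = lshift a v.
Proof. by move/funext->. Qed.

Let conv u v n := \sum_(i < n.+1) u i * v (n - i)%N.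

Lemma lmul_lshift a b u v :
  lmul (lshift a u) (lshift b v) = lshift (a + b) (conv u v).
Proof.
apply: lshift_eq => [i iab|n] /=.
  by apply: lmul_coef0 iab => ?; exact: lshift_lt.
rewrite (@lmul_coefE _ _ a b); try by move=> ?; exact: lshift_lt.
by apply: eq_bigr => i _; rewrite !lshiftE.
Qed.

(* Convolutions are computed as products of truncated polynomials. *)
Let convE N u v n : (n < N)%N ->
  conv u v n = ((\poly_(i < N) u i) * (\poly_(i < N) v i))`_n.
Proof.
move=> nN; rewrite coefM; apply: eq_bigr => i _; rewrite !coef_poly.
by rewrite (leq_ltn_trans (leq_ord i))// (leq_ltn_trans (leq_subr _ _)).
Qed.

Let convC u v : conv u v =1 conv v u.
Proof. by move=> n; rewrite !(@convE n.+1)// mulrC. Qed.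

Let convA u v w : conv u (conv v w) =1 conv (conv u v) w.
Proof.
move=> n; pose P u := \poly_(i < n.+1) u i.
transitivity ((P u * (P v * P w))`_n).
  rewrite coefM; apply: eq_bigr => i _.
  by rewrite -(@convE n.+1) ?ltnS ?leq_subr// coef_poly ltn_ord.
rewrite mulrA coefM; apply: eq_bigr => i _.
by rewrite -(@convE n.+1)// coef_poly ltnS leq_subr.
Qed.

Let lshift_exists f : {a & {u | f = lshift a u}}.
Proof.
case: (cid (lcoefP f)) => a fa; exists a.
by exists (fun n => f (a + n%:Z)); apply: lshiftK.
Qed.

Lemma lmulC : commutative lmul.
Proof.
move=> f g; have [a [u ->]] := lshift_exists f; have [b [v ->]] := lshift_exists g.
by rewrite !lmul_lshift addrC; exact/lshift_ext/convC.
Qed.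

Lemma lmulA : associative lmul.
Proof.
move=> f g h; have [a [u ->]] := lshift_exists f.
have [b [v ->]] := lshift_exists g; have [c [w ->]] := lshift_exists h.
by rewrite !lmul_lshift addrA; exact/lshift_ext/convA.
Qed.

Lemma lone_lshift : lone = lshift 0 (fun n => (n == 0)%:R).
Proof.
apply: lshift_eq => [i i0|n]; first by rewrite /= lt_eqF.
by rewrite add0r.
Qed.

Lemma lmul1 : left_id lone lmul.
Proof.
move=> f; have [a [u ->]] := lshift_exists f.
rewrite lone_lshift lmul_lshift add0r; apply: lshift_ext => n.
rewrite /conv big_ord_recl /= mul1r subn0 big1 ?addr0// => i _.
by rewrite mul0r.
Qed.

Lemma lmulDl : left_distributive lmul ladd.
Proof.
move=> f g h; apply: laurentP => k /=.
case: (lcoefP f) (lcoefP g) (lcoefP h) => a fa [b gb] [c hc].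
pose m := Num.min a b.
have fm i : i < m -> f i = 0 by rewrite lt_min => /andP[? _]; exact: fa.
have gm i : i < m -> g i = 0 by rewrite lt_min => /andP[_ ?]; exact: gb.
have fgm i : i < m -> ladd f g i = 0.
  by move=> im /=; rewrite fm// gm// addr0.
have [kl|] := ltP k (m + c).
  by rewrite !(@lmul_coef0 _ _ m c)// addr0.
rewrite -subr_ge0 -{2 3 4}(subrKC (m + c) k); case: (k - _) => // n _.
rewrite !(@lmul_coefE _ _ m c)// -big_split /=.
by apply: eq_bigr => i _; rewrite mulrDl.
Qed.

Lemma laddA : associative ladd.
Proof. by move=> f g h; apply: laurentP => i /=; rewrite addrA. Qed.
Lemma laddC : commutative ladd.
Proof. by move=> f g; apply: laurentP => i /=; rewrite addrC. Qed.
Lemma ladd0 : left_id lzero ladd.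
Proof. by move=> f; apply: laurentP => i /=; rewrite add0r. Qed.
Lemma laddN : left_inverse lzero lopp ladd.
Proof. by move=> f; apply: laurentP => i /=; rewrite addNr. Qed.

Lemma lone_neq0 : lone != lzero.
Proof.
apply/eqP => /(congr1 (fun f => lcoef f 0))/= /eqP.
by rewrite oner_eq0.
Qed.

Let conv_inv_seq u n : seq F :=
  iter n (fun s => rcons s
    (if size s == 0 then (u 0%N)^-1
     else - (u 0%N)^-1 * \sum_(i < size s) u i.+1 * s`_(size s - i.+1))) [::].

Let conv_inv u n := (conv_inv_seq u n.+1)`_n.

Let conv_invP u : u 0%N != 0 -> conv u (conv_inv u) =1 (fun n => (n == 0)%:R).
Proof.
move=> u0.
have sz l : size (conv_inv_seq u l) = l.
  by elim: l => //= l IH; rewrite size_rcons IH.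
have stab l n : (n < l)%N -> (conv_inv_seq u l)`_n = conv_inv u n.
  elim: l => // l IH; rewrite ltnS leq_eqVlt => /predU1P[->//|nl].
  by rewrite /= nth_rcons sz nl IH.
case=> [|n]; rewrite /conv big_ord_recl subn0.
  by rewrite big_ord0 addr0 /conv_inv /= mulfV.
have -> : conv_inv u n.+1 = - (u 0%N)^-1 *
    \sum_(i < n.+1) u i.+1 * (conv_inv_seq u n.+1)`_(n.+1 - i.+1).
  rewrite /conv_inv /conv_inv_seq iterS -/(conv_inv_seq u n.+1).
  by rewrite nth_rcons !sz ltnn eqxx.
rewrite mulNr mulrN mulVKf//; apply/eqP; rewrite addrC subr_eq0; apply/eqP.
by apply: eq_bigr => i _; rewrite stab// subSS ltnS leq_subr.
Qed.

Lemma linv_exists f : exists g, (f != lzero -> lmul g f = lone) /\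
  (f = lzero -> g = lzero).
Proof.
have [->|f0] := eqVneq f lzero; first by exists lzero.
have [a [u fE]] := lshift_exists f.
have uex : exists n, u n != 0.
  apply: contrapT => u0; move/eqP: f0; apply; rewrite fE.
  apply: esym; apply: lshift_eq => // n /=.
  by apply: esym; apply/eqP/negP => /negP un; apply: u0; exists n.
case: (ex_minnP uex) => n un0 un.
have {}fE : f = lshift (a + n%:Z) (fun i => u (n + i)%N).
  apply: lshift_eq => [i|i]; rewrite fE; last by rewrite -addrA -PoszD lshiftE.
  have [ia|] := ltP i a; first by rewrite lshift_lt.
  rewrite -(subrKC a i) -subr_ge0 addrAC subrr add0r.
  case: (i - a) => // j _; rewrite ltrD2l ltz_nat lshiftE => jn.
  by apply/eqP; apply: contraTT jn => /un; rewrite -leqNgt.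
pose v i := u (n + i)%N.
exists (lshift (- (a + n%:Z)) (conv_inv v)); split=> [_|/eqP]; last first.
  by rewrite (negPf f0).
rewrite lmulC fE lmul_lshift subrr lone_lshift; apply/lshift_ext/conv_invP.
by rewrite /v addn0.
Qed.

Definition linv f := sval (cid (linv_exists f)).

Lemma lmulV f : f != lzero -> lmul (linv f) f = lone.
Proof. by have [fV _] := svalP (cid (linv_exists f)); exact: fV. Qed.

Lemma linv0 : linv lzero = lzero.
Proof. by have [_ f0] := svalP (cid (linv_exists lzero)); exact: f0. Qed.

End LaurentField.

HB.instance Definition _ (F : fieldType) := GRing.isZmodule.Build (laurent F)
  (@laddA F) (@laddC F) (@ladd0 F) (@laddN F).
HB.instance Definition _ (F : fieldType) :=
  GRing.Zmodule_isComNzRing.Build (laurent F)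
  (@lmulA F) (@lmulC F) (@lmul1 F) (@lmulDl F) (lone_neq0 F).
HB.instance Definition _ (F : fieldType) :=
  GRing.ComNzRing_isField.Build (laurent F) (@lmulV F) (linv0 F).

(* F[[t]], the valuation ring of the t-adic valuation *)
Definition laurent_int (F : fieldType) : {pred laurent F} :=
  fun f => `[< forall i : int, i < 0 -> f i = 0 >].

(* Terms are those of ssralg, whose variables 'X_i are indexed by nat and whose
   constants name elements of R; GRing.rterm excludes the inversion symbol,
   which belongs to neither language. *)
Inductive formula (R : Type) : Type :=
| Equal of GRing.term R & GRing.term R
| InO of GRing.term R
| And of formula R & formula R
| Or of formula R & formula R
| Implies of formula R & formula R
| Not of formula R
| Exists of nat & formula R
| Forall of nat & formula R.

Fixpoint Lval_formula (R : unitRingType) (f : formula R) : bool :=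
  match f with
  | Equal t1 t2 => GRing.rterm t1 && GRing.rterm t2
  | InO t => GRing.rterm t
  | And f1 f2 | Or f1 f2 | Implies f1 f2 => Lval_formula f1 && Lval_formula f2
  | Not f1 | Exists _ f1 | Forall _ f1 => Lval_formula f1
  end.

Fixpoint Lring_formula (R : unitRingType) (f : formula R) : bool :=
  match f with
  | Equal t1 t2 => GRing.rterm t1 && GRing.rterm t2
  | InO _ => false
  | And f1 f2 | Or f1 f2 | Implies f1 f2 => Lring_formula f1 && Lring_formula f2
  | Not f1 | Exists _ f1 | Forall _ f1 => Lring_formula f1
  end.

Fixpoint quantifier_free (R : Type) (f : formula R) : bool :=
  match f with
  | Equal _ _ | InO _ => true
  | And f1 f2 | Or f1 f2 | Implies f1 f2 =>
      quantifier_free f1 && quantifier_free f2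
  | Not f1 => quantifier_free f1
  | Exists _ _ | Forall _ _ => false
  end.

Fixpoint existential (R : Type) (f : formula R) : bool :=
  if f is Exists _ f1 then existential f1 else quantifier_free f.

Fixpoint term_params_in (R : Type) (C : {pred R}) (t : GRing.term R) : bool :=
  match t with
  | GRing.Var _ | GRing.NatConst _ => true
  | GRing.Const c => c \in C
  | GRing.Add t1 t2 | GRing.Mul t1 t2 =>
      term_params_in C t1 && term_params_in C t2
  | GRing.Opp t1 | GRing.NatMul t1 _ | GRing.Inv t1 | GRing.Exp t1 _ =>
      term_params_in C t1
  end.

Fixpoint params_in (R : Type) (C : {pred R}) (f : formula R) : bool :=
  match f with
  | Equal t1 t2 => term_params_in C t1 && term_params_in C t2
  | InO t => term_params_in C t
  | And f1 f2 | Or f1 f2 | Implies f1 f2 => params_in C f1 && params_in C f2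
  | Not f1 | Exists _ f1 | Forall _ f1 => params_in C f1
  end.

Fixpoint term_vars (R : Type) (t : GRing.term R) : seq nat :=
  match t with
  | GRing.Var i => [:: i]
  | GRing.Const _ | GRing.NatConst _ => [::]
  | GRing.Add t1 t2 | GRing.Mul t1 t2 => term_vars t1 ++ term_vars t2
  | GRing.Opp t1 | GRing.NatMul t1 _ | GRing.Inv t1 | GRing.Exp t1 _ =>
      term_vars t1
  end.

Fixpoint free_vars (R : Type) (f : formula R) : seq nat :=
  match f with
  | Equal t1 t2 => term_vars t1 ++ term_vars t2
  | InO t => term_vars t
  | And f1 f2 | Or f1 f2 | Implies f1 f2 => free_vars f1 ++ free_vars f2
  | Not f1 => free_vars f1
  | Exists i f1 | Forall i f1 => [seq j <- free_vars f1 | j != i]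
  end.

(* Satisfaction in the structure (R, O); as in GRing.holds, the variable 'X_i
   takes the value e`_i. *)
Fixpoint holds (R : unitRingType) (O : {pred R}) (e : seq R) (f : formula R)
    {struct f} : Prop :=
  match f with
  | Equal t1 t2 => GRing.eval e t1 = GRing.eval e t2
  | InO t => GRing.eval e t \in O
  | And f1 f2 => holds O e f1 /\ holds O e f2
  | Or f1 f2 => holds O e f1 \/ holds O e f2
  | Implies f1 f2 => holds O e f1 -> holds O e f2
  | Not f1 => ~ holds O e f1
  | Exists i f1 => exists x, holds O (set_nth 0 e i x) f1
  | Forall i f1 => forall x, holds O (set_nth 0 e i x) f1
  end.

(* Equivalence modulo the theory of (R, O) with constants: that theory being
   complete, this says that f and g define the same set in R. *)
Definition equivalent (R : unitRingType) (O : {pred R}) (f g : formula R) : Prop :=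
  free_vars f =i free_vars g /\ forall e : seq R, holds O e f <-> holds O e g.

(* Main.v *)
Require Import Defs.
From mathcomp Require Import all_boot all_order all_algebra.
From mathcomp Require Import finfield boolp zify ring.

(** Following Anscombe and Koenigsmann, with [f = X^q - X + 1]: this polynomial
    has no root in [F_q], so [1 / f(x)] is integral for every [x] in
    [F_q((t))]; and since [f' = -1], Hensel's lemma shows that [1 / f] takes all
    values in [1 + t F_q[[t]]].  As [F_q] is the set of roots of [X^q - X],
    [F_q[[t]] = {c + 1 / f(x) | c^q = c}].  Moreover [w |-> w^q - w] maps
    [F_q[[t]]] onto [t F_q[[t]]], so [u] is not integral iff
    [u (w^q - w) = 1] for some integral [w].  Both [O] and its complement being
    existentially definable without parameters, so is each boolean combination
    of them. *)

Set Implicit Arguments.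
Unset Strict Implicit.
Unset Printing Implicit Defensive.

Import Order.TTheory GRing.Theory Num.Theory.
Local Open Scope ring_scope.

(** * Lower bounds for the valuation, and the equation [x ^+ n - x = z] in the maximal ideal *)

Section Valuation.
Variable F : fieldType.
Implicit Types (f g x y z : laurent F) (a b : int) (n : nat).

(** Lower bounds replace a valuation function: the zero series satisfies all of them, so no infinite
    value is needed. *)
Definition val_ge a f := forall i, i < a -> f i = 0.

Lemma val_geW a b f : a <= b -> val_ge b f -> val_ge a f.
Proof. by move=> ab fb i ia; apply: fb; apply: lt_le_trans ab. Qed.

Lemma val_geD a f g : val_ge a f -> val_ge a g -> val_ge a (f + g).
Proof.
by move=> fa ga i ia; rewrite -[LHS]/(f i + g i) fa// ga// addr0.
Qed.

Lemma val_geN a f : val_ge a f -> val_ge a (- f).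
Proof. by move=> fa i ia; rewrite -[LHS]/(- f i) fa// oppr0. Qed.

Lemma val_geB a f g : val_ge a f -> val_ge a g -> val_ge a (f - g).
Proof. by move=> fa /val_geN; apply: val_geD. Qed.

Lemma val_geM a b f g : val_ge a f -> val_ge b g -> val_ge (a + b) (f * g).
Proof. by move=> fa gb k; apply: lmul_coef0. Qed.

Lemma val_ge1 : val_ge 0 (1 : laurent F).
Proof. by move=> i i0; rewrite -[LHS]/((i == 0)%:R : F) lt_eqF. Qed.

Lemma val_geX f n : val_ge 0 f -> val_ge 0 (f ^+ n).
Proof.
move=> f0; elim: n => [|n IH]; first by rewrite expr0; apply: val_ge1.
by rewrite exprS -[0]addr0; apply: val_geM.
Qed.

Lemma val_geX_gt0 f n : (0 < n)%N -> val_ge 1 f -> val_ge 1 (f ^+ n).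
Proof.
case: n => // n _ f1; rewrite exprS -[1]addr0; apply: val_geM => //.
by apply: val_geX; apply: val_geW f1.
Qed.

Lemma val_ge1F : ~ val_ge 1 (1 : laurent F).
Proof.
by move=> /(_ 0 ltr01) /eqP; rewrite -[X in X == _]/(1 : F) oner_eq0.
Qed.

(** In the lowest degree the convolution has a single term. For [a = b = 0] this makes [f |-> f 0]
    multiplicative on integral series; in general it multiplies leading coefficients. *)
Lemma coefM_val_ge a b f g : val_ge a f -> val_ge b g ->
  (f * g) (a + b) = f a * g b.
Proof.
move=> fa gb; have := @lmul_coefE _ f g a b 0 fa gb.
by rewrite big_ord1 subn0 !addr0.
Qed.

Lemma coef0X f n : val_ge 0 f -> (f ^+ n) 0 = f 0 ^+ n.
Proof.
move=> f0; elim: n => [|n IH]; first by rewrite !expr0.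
rewrite !exprS -IH -[X in (f * _) X](addr0 0).
by rewrite coefM_val_ge//; apply: val_geX.
Qed.

Lemma val_ge1E f : val_ge 1 f <-> val_ge 0 f /\ f 0 = 0.
Proof.
split=> [f1|[f0 f00] i]; first by split; [apply: val_geW f1|apply: f1].
case: (ltgtP i 0) => [i0 _|i0|-> //]; first exact: f0.
by rewrite ltNge -gtz0_ge1 i0.
Qed.

Lemma lead_exists f : f != 0 -> exists2 a, val_ge a f & f a != 0.
Proof.
move=> f0; case: (lcoefP f) => m fm.
have nex : exists n : nat, f (m + n%:Z) != 0.
  apply: contrapT => nex; move/eqP: f0; apply; apply: laurentP => i.
  rewrite -[RHS]/(0 : F).
  have [/fm//|] := ltP i m; rewrite -subr_ge0 -{2}(subrKC m i).
  by case: (i - m) => // n _; apply/eqP/negP => /negP fn; apply: nex; exists n.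
case: (ex_minnP nex) => n fn nmin; exists (m + n%:Z) => // i.
have [/fm//|] := ltP i m; rewrite -subr_ge0 -{2 3}(subrKC m i).
case: (i - m) => // j _; rewrite ltrD2l ltz_nat => jn.
by apply/eqP; apply: contraTT jn => /nmin; rewrite -leqNgt.
Qed.

(** The leading degrees of [f] and [f^-1] add up to 0, since the product of the leading coefficients
    is a nonzero coefficient of [1]. *)
Lemma val_ge_inv f : ~ val_ge 0 f -> val_ge 1 f^-1.
Proof.
move=> fN; have f0 : f != 0 by apply/eqP => fE; apply: fN; rewrite fE.
have [a fa fa0] := lead_exists f0.
have [b gb gb0] : exists2 a, val_ge a f^-1 & f^-1 a != 0.
  by apply: lead_exists; rewrite invr_eq0.
have a0 : a < 0 by rewrite ltNge; apply/negP => /val_geW/(_ fa).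
have : (f * f^-1) (a + b) != 0 by rewrite coefM_val_ge// mulf_neq0.
rewrite mulfV// -[X in X != _]/((a + b == 0)%:R : F) => ab.
apply: val_geW gb; move: ab a0.
by have [/eqP|_] := eqVneq (a + b) 0; [lia|rewrite eqxx].
Qed.

Lemma val_ge0_or_inv f : val_ge 0 f \/ val_ge 1 f^-1.
Proof. by have [|/val_ge_inv] := pselect (val_ge 0 f); [left|right]. Qed.

Lemma val_ge0V f : ~ val_ge 1 f -> val_ge 0 f^-1.
Proof. by case: (val_ge0_or_inv f^-1) => //; rewrite invrK. Qed.

Lemma val_geBX a x y n : val_ge 0 x -> val_ge 0 y ->
  val_ge a (x - y) -> val_ge a (x ^+ n - y ^+ n).
Proof.
move=> x0 y0 xy; elim: n => [|n IH]; first by rewrite subrr.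
have -> : x ^+ n.+1 - y ^+ n.+1 = x * (x ^+ n - y ^+ n) + (x - y) * y ^+ n.
  by rewrite !exprS; ring.
apply: val_geD; first by rewrite -[a]add0r; apply: val_geM.
by rewrite -[a]addr0; apply: val_geM => //; apply: val_geX.
Qed.

(** In the telescoped form of [x ^+ n - y ^+ n] each summand is a multiple of [x - y] and, as
    [n > 1], has a further factor from the maximal ideal. *)
Lemma val_geBX_contract a x y n : (1 < n)%N -> val_ge 1 x -> val_ge 1 y ->
  val_ge a (x - y) -> val_ge (1 + a) (x ^+ n - y ^+ n).
Proof.
case: n => [|[|n]]// _ x1 y1 xy.
have -> : x ^+ n.+2 - y ^+ n.+2 =
    x * (x ^+ n.+1 - y ^+ n.+1) + y ^+ n.+1 * (x - y).
  by rewrite !exprS; ring.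
have [x0 y0] : val_ge 0 x /\ val_ge 0 y by split; [exact: val_geW x1|exact: val_geW y1].
by apply: val_geD; apply: val_geM => //; [exact: val_geBX|exact: val_geX_gt0].
Qed.

(* The fixed point of the contraction [x |-> x ^+ n - z] of [t F[[t]]]. *)
Lemma val_ge1_root n z : (1 < n)%N -> val_ge 1 z ->
  exists2 x, val_ge 1 x & x ^+ n - x = z.
Proof.
move=> n1 z1; pose X := fix X k : laurent F := if k is l.+1 then X l ^+ n - z else 0.
have X1 k : val_ge 1 (X k).
  by elim: k => // k IH; apply: val_geB => //; apply: val_geX_gt0 => //; apply: ltnW.
have dX k : val_ge (1 + k%:Z) (X k.+1 - X k).
  elim: k => [|k IH]; first exact: val_geB.
  have dB (a b c : laurent F) : a - c - (b - c) = a - b by ring.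
  rewrite -[X k.+2 - _]/(X k.+1 ^+ n - z - (X k ^+ n - z)) dB [k.+1%:Z]intS.
  exact: val_geBX_contract.
have Xstab j k : val_ge (1 + j%:Z) (X (j + k)%N - X j).
  elim: k => [|k IH]; first by rewrite addn0 subrr.
  rewrite addnS -[_ - X j](subrKA (X (j + k)%N)); apply: val_geD => //.
  by apply: val_geW (dX _); lia.
(* The limit is read off diagonally: the coefficient of degree [k] is constant from [X k] on. *)
pose x := Defs.lshift 0 (fun k => X k k%:Z).
have xX k : val_ge (1 + k%:Z) (x - X k).
  move=> i ik; rewrite -[LHS]/(x i - X k i).
  case: i ik => [i|i] ik; last by rewrite lshift_lt// X1// subrr.
  have -> : k = (i + (k - i))%N by lia.
  rewrite -[Z in x Z]add0r lshiftE.
  have ii : i%:Z < 1 + i%:Z by lia.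
  have := Xstab i (k - i)%N _ ii; rewrite -[LHS]/(X (i + (k - i))%N i - X i i).
  by move=> /eqP; rewrite subr_eq0 => /eqP->; rewrite subrr.
have x1 : val_ge 1 x by rewrite -[x]subr0; apply: (xX 0%N).
exists x => //; apply: subr0_eq; apply: laurentP => i.
rewrite -[RHS]/(0 : F); pose k := `|i|%N.
(* Since [X k.+1] is [X k ^+ n - z], the error splits into two differences of valuation above [k],
   hence vanishes in degree [i]. *)
have -> : x ^+ n - x - z = (x ^+ n - X k ^+ n) - (x - X k.+1).
  by rewrite /=; ring.
suff: val_ge (1 + k%:Z) (x ^+ n - X k ^+ n - (x - X k.+1)).
  by apply; rewrite /k; lia.
apply: val_geB; last by apply: val_geW (xX _); lia.
by apply: val_geBX => //; apply: val_geW (X1 _) || apply: val_geW x1.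
Qed.

Definition lconst (c : F) : laurent F := Defs.lshift 0 (fun n => if n is 0%N then c else 0).

Lemma val_ge_lconst c : val_ge 0 (lconst c).
Proof. by move=> i; apply: lshift_lt. Qed.

Lemma lconst0 c : lconst c 0 = c.
Proof. by rewrite -[X in lconst c X](addr0 0) lshiftE. Qed.

Lemma lconstM c d : lconst c * lconst d = lconst (c * d).
Proof.
rewrite -[LHS]/(lmul _ _) lmul_lshift addr0; apply: lshift_ext => -[|n].
  by rewrite big_ord1.
rewrite big_ord_recl subn0 mulr0 add0r big1// => i _.
by rewrite lift0 mul0r.
Qed.

Lemma lconstX c n : (0 < n)%N -> lconst c ^+ n = lconst (c ^+ n).
Proof. by elim: n => // -[|n] IH _; rewrite ?expr1// exprS IH// lconstM -exprS. Qed.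

End Valuation.

(** * Existential definitions of the valuation ring and of its complement *)

Section Definability.
Variable F : finFieldType.
Let q := #|F|.
Implicit Types (c u w x : laurent F).

Let q_gt1 : (1 < q)%N := finRing_gt1 F.

Lemma laurent_intP u : u \in @laurent_int F <-> val_ge 0 u.
Proof. by split=> [/asboolP//|u0]; apply/asboolP. Qed.

(** The constant coefficient is computed in [F], where the [q]-th power is the identity. *)
Lemma val_ge1_frobB x : val_ge 0 x -> val_ge 1 (x ^+ q - x).
Proof.
move=> x0; apply/val_ge1E; split; first by apply: val_geB => //; apply: val_geX.
by rewrite -[LHS]/((x ^+ q) 0 - x 0) coef0X// expf_card subrr.
Qed.

(** For nonzero [c] the power of [c^-1] with exponent [q.-1] is [1], so [c^-1] cannot lie in the
    maximal ideal. *)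
Lemma val_ge0_frob_fixed c : c ^+ q = c -> val_ge 0 c.
Proof.
move=> cq; have [//|c1] := val_ge0_or_inv c.
have [->//|c0] := eqVneq c 0; exfalso; apply: (@val_ge1F F).
suff <- : c^-1 ^+ q.-1 = 1 by apply: val_geX_gt0 => //; lia.
apply: (mulfI (invr_neq0 c0)).
by rewrite -exprS prednK 1?ltnW// exprVn cq mulr1.
Qed.

(** For integral [x] the value is [1] modulo the maximal ideal. Otherwise [y = x^-1] is in that
    ideal, and dividing by [x ^+ q] would write [1] as a sum of elements of it. *)
Lemma frobB1_nval_ge1 x : ~ val_ge 1 (x ^+ q - x + 1).
Proof.
move=> f1; apply: (@val_ge1F F); have [x0|y1] := val_ge0_or_inv x.
  rewrite -[X in val_ge _ X](addKr (x ^+ q - x)) addrC.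
  by apply: val_geB => //; apply: val_ge1_frobB.
(* As the inverse of [0] is [0], the remaining alternative does not yet exclude [x = 0]. *)
have [x0|x0] := eqVneq x 0.
  by move: f1; rewrite x0 expr0n gtn_eqF 1?ltnW// subr0 add0r.
set y := x^-1 in y1.
have -> : 1 = (x ^+ q - x + 1) * y ^+ q + y ^+ q.-1 - y ^+ q :> laurent F.
  have xy : x ^+ q * y ^+ q = 1 by rewrite -exprMn mulfV// expr1n.
  have xy' : x * y ^+ q = y ^+ q.-1.
    by rewrite -{1}(prednK (ltnW q_gt1)) exprS mulVKf.
  by rewrite mulrDl mulrBl xy xy'; ring.
have yk k : (0 < k)%N -> val_ge 1 (y ^+ k) by move=> k0; apply: val_geX_gt0.
apply: val_geB; last by apply: yk; lia.
apply: val_geD; last by apply: yk; lia.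
rewrite -[1]addr0; apply: val_geM => //.
by apply: val_geW (yk _ _) => //; lia.
Qed.

Lemma laurent_int_def u : u \in @laurent_int F <->
  exists c x, c ^+ q = c /\ (u - c) * (x ^+ q - x + 1) = 1.
Proof.
rewrite laurent_intP; split=> [u0|[c [x [/val_ge0_frob_fixed c0 ux]]]]; last first.
  rewrite -(subrK c u); apply: val_geD => //.
  have /val_ge0V := @frobB1_nval_ge1 x.
  have f0 : x ^+ q - x + 1 != 0.
    by apply: contra_eq_neq ux => ->; rewrite mulr0 eq_sym oner_eq0.
  by rewrite -(mulfK f0 (u - c)) ux mul1r.
(* Subtracting [c] makes the constant coefficient [1], so that [(u - c)^-1 - 1] is in the maximal
   ideal and has the form [x ^+ q - x]. *)
pose c := lconst (u 0 - 1); have c0 : val_ge 0 c := @val_ge_lconst _ _.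
have w1 : val_ge 1 (u - c - 1).
  apply/val_ge1E; split; first exact: val_geB (val_geB u0 c0) (@val_ge1 F).
  rewrite -[LHS]/(u 0 - c 0 - 1 : F) /c lconst0; ring.
have wN1 : ~ val_ge 1 (u - c).
  by move=> uc; apply: (@val_ge1F F); rewrite -(subKr (u - c) 1); apply: val_geB.
have w0 : u - c != 0 by apply/eqP => w0; apply: wN1; rewrite w0.
have z1 : val_ge 1 ((u - c)^-1 - 1).
  have -> : (u - c)^-1 - 1 = - ((u - c - 1) * (u - c)^-1).
    by rewrite mulrBl mulfV// mul1r opprB.
  by apply: val_geN; rewrite -[1]addr0; apply: val_geM => //; apply: val_ge0V.
have [x _ xE] := val_ge1_root q_gt1 z1.
exists c, x; split; last by rewrite xE subrK mulfV.
by rewrite lconstX ?expf_card// ltnW.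
Qed.

(** The condition on [w] is membership rather than non-membership, so [laurent_int_def] turns the
    whole into an existential condition. *)
Lemma laurent_nint_def u : u \notin @laurent_int F <->
  exists2 w, w \in @laurent_int F & u * (w ^+ q - w) = 1.
Proof.
split=> [/negP uN|[w /laurent_intP/val_ge1_frobB w1 uw]].
  have u1 : val_ge 1 u^-1 by apply: val_ge_inv => /laurent_intP.
  have [w w1 wE] := val_ge1_root q_gt1 u1.
  exists w; first by apply/laurent_intP; apply: val_geW w1.
  rewrite wE mulfV//; apply/eqP => u0.
  by apply: uN; apply/laurent_intP; rewrite u0.
apply/negP => /laurent_intP u0; apply: (@val_ge1F F).
by rewrite -uw -[1]add0r; apply: val_geM.
Qed.

End Definability.

(** * Coincidence lemma and blocks of existential quantifiers *)

Section Syntax.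
Variable R : unitRingType.
Implicit Types (t : GRing.term R) (f : formula R) (e : seq R) (O C : {pred R}).

Lemma eval_ext e e' t : {in term_vars t, forall i, e`_i = e'`_i} ->
  GRing.eval e t = GRing.eval e' t.
Proof.
elim: t => //=.
- by move=> i; apply; rewrite inE.
- move=> t1 IH1 t2 IH2 ee'; rewrite IH1 ?IH2// => i it; apply: ee';
    by rewrite mem_cat it ?orbT.
- by move=> t IH /IH->.
- by move=> t IH n /IH->.
- move=> t1 IH1 t2 IH2 ee'; rewrite IH1 ?IH2// => i it; apply: ee';
    by rewrite mem_cat it ?orbT.
- by move=> t IH /IH->.
- by move=> t IH n /IH->.
Qed.

(** Environments are compared entry by entry because unset entries read as [0]: lists of different
    lengths may give all variables the same values. *)
Lemma holds_ext O f e e' : {in free_vars f, forall i, e`_i = e'`_i} ->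
  holds O e f <-> holds O e' f.
Proof.
have catl (s1 s2 : seq nat) (P : nat -> Prop) :
    {in s1 ++ s2, forall i, P i} -> {in s1, forall i, P i} /\ {in s2, forall i, P i}.
  by move=> sP; split=> i si; apply: sP; rewrite mem_cat si ?orbT.
elim: f e e' => /=.
- by move=> t1 t2 e e' /catl[/eval_ext-> /eval_ext->].
- by move=> t e e' /eval_ext->.
- by move=> f1 IH1 f2 IH2 e e' /catl[/IH1-> /IH2->].
- by move=> f1 IH1 f2 IH2 e e' /catl[/IH1-> /IH2->].
- by move=> f1 IH1 f2 IH2 e e' /catl[/IH1-> /IH2->].
- by move=> f IH e e' /IH->.
- move=> k f IH e e' ee'.
  have upd x : {in free_vars f, forall i,
      (set_nth 0 e k x)`_i = (set_nth 0 e' k x)`_i}.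
    move=> i fi; rewrite !nth_set_nth /=; case: eqVneq => // ik.
    by apply: ee'; rewrite mem_filter ik.
  by split=> -[x fx]; exists x; [rewrite -(IH _ _ (upd x))|rewrite (IH _ _ (upd x))].
- move=> k f IH e e' ee'.
  have upd x : {in free_vars f, forall i,
      (set_nth 0 e k x)`_i = (set_nth 0 e' k x)`_i}.
    move=> i fi; rewrite !nth_set_nth /=; case: eqVneq => // ik.
    by apply: ee'; rewrite mem_filter ik.
  by split=> fx x; [rewrite -(IH _ _ (upd x))|rewrite (IH _ _ (upd x))].
Qed.

Fixpoint exists_block n k f : formula R :=
  if k is l.+1 then Exists n (exists_block n.+1 l f) else f.

Lemma holds_exists_block O n k f e : holds O e (exists_block n k f) <->
  exists2 e', {in [predC index_iota n (n + k)%N], forall i, e'`_i = e`_i}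
    & holds O e' f.
Proof.
elim: k n e => [|k IH] n e /=.
  split=> [fe|[e' ee' fe']]; first by exists e.
  (* An empty block forces [e'] and [e] to agree at every index, not to be the same list. *)
  have ee'f : {in free_vars f, forall i, e'`_i = e`_i}.
    by move=> i _; apply: ee'; rewrite inE mem_index_iota addn0; lia.
  exact/(holds_ext O ee'f).
split=> [[x /IH[e' ee' fe']]|[e' ee' fe']].
  exists e' => // i; rewrite inE mem_index_iota => ni.
  rewrite ee' ?inE ?mem_index_iota; last by lia.
  by rewrite nth_set_nth /= ifF//; lia.
exists e'`_n; apply/IH; exists e' => // i; rewrite inE mem_index_iota => ni.
rewrite nth_set_nth /=; case: eqVneq => [->//|i_n].
by apply: ee'; rewrite inE mem_index_iota; lia.
Qed.

Lemma free_vars_exists_block n k f i :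
  (i \in free_vars (exists_block n k f)) =
  (i \notin index_iota n (n + k)%N) && (i \in free_vars f).
Proof.
elim: k n => [|k IH] n /=; first by rewrite mem_index_iota addn0; lia.
by rewrite mem_filter IH !mem_index_iota andbA; congr (_ && _); lia.
Qed.

Lemma existential_exists_block n k f :
  quantifier_free f -> existential (exists_block n k f).
Proof. by move=> qf; elim: k n => //=; case: f qf. Qed.

Lemma Lring_exists_block n k f :
  Lring_formula (exists_block n k f) = Lring_formula f.
Proof. by elim: k n => //= k IH n; apply: IH. Qed.

Lemma params_in_exists_block C n k f :
  params_in C (exists_block n k f) = params_in C f.
Proof. by elim: k n => //= k IH n; apply: IH. Qed.

(** * Elimination of [O] from quantifier-free formulas *)

Variables (q : nat) (O : {pred R}).
Hypothesis O_def : forall u, u \in O <->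
  exists c x, c ^+ q = c /\ (u - c) * (x ^+ q - x + 1) = 1.
Hypothesis nO_def : forall u, u \notin O <->
  exists2 w, w \in O & u * (w ^+ q - w) = 1.

Local Notation "''X_' i" := (GRing.Var R i) : term_scope.

(** The variables [n] and [n.+1] stand for [c] and [x] of [O_def]. *)
Definition in_witness n t : formula R :=
  And (Equal ('X_n ^+ q)%T 'X_n%T)
      (Equal ((t + - 'X_n) * ('X_n.+1 ^+ q + - 'X_n.+1 + 1%:R))%T (1%:R)%T).

(** The variable [n.+2] stands for [w] of [nO_def], while [n] and [n.+1] now certify that [w], not
    [t], is in [O]. *)
Definition notin_witness n t : formula R :=
  And (in_witness n 'X_n.+2%T) (Equal (t * ('X_n.+2 ^+ q + - 'X_n.+2))%T (1%:R)%T).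

(** There is no converse in a fixed environment: membership of [t] does not make the given values
    witnesses. [decided] makes up for this. *)
Lemma holds_in_witness e n t : holds O e (in_witness n t) -> GRing.eval e t \in O.
Proof. by move=> /= h; apply/O_def; exists e`_n, e`_n.+1. Qed.

Lemma holds_notin_witness e n t :
  holds O e (notin_witness n t) -> GRing.eval e t \notin O.
Proof.
by move=> [/holds_in_witness/= wO /= h]; apply/nO_def; exists e`_n.+2.
Qed.

Fixpoint nb_atoms f : nat :=
  match f with
  | InO _ => 1
  | And f1 f2 | Or f1 f2 | Defs.Implies f1 f2 => (nb_atoms f1 + nb_atoms f2)%N
  | Not f1 | Exists _ f1 | Forall _ f1 => nb_atoms f1
  | Equal _ _ => 0
  end.

(* The j-th atom [InO t] is given the variables n + 3j, n + 3j + 1, n + 3j + 2;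
   [decided] says that they witness [t \in O] or [t \notin O], and under this
   condition [ring_form] may replace positive and negative occurrences alike
   by [in_witness]. *)
Fixpoint ring_form n f : formula R :=
  match f with
  | InO t => in_witness n t
  | And f1 f2 => And (ring_form n f1) (ring_form (n + 3 * nb_atoms f1)%N f2)
  | Or f1 f2 => Or (ring_form n f1) (ring_form (n + 3 * nb_atoms f1)%N f2)
  | Defs.Implies f1 f2 => Defs.Implies (ring_form n f1) (ring_form (n + 3 * nb_atoms f1)%N f2)
  | Not f1 => Not (ring_form n f1)
  | _ => f
  end.

Fixpoint decided n f : formula R :=
  match f with
  | InO t => Or (in_witness n t) (notin_witness n t)
  | And f1 f2 | Or f1 f2 | Defs.Implies f1 f2 =>
      And (decided n f1) (decided (n + 3 * nb_atoms f1)%N f2)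
  | Not f1 => decided n f1
  | _ => Equal (0%:R)%T (0%:R)%T
  end.

(** If [notin_witness] holds for an atom, soundness refutes its [in_witness]. So every atom has the
    truth value of its replacement, and all connectives, negation included, preserve this. *)
Lemma holds_ring_form e n f : quantifier_free f -> holds O e (decided n f) ->
  holds O e f <-> holds O e (ring_form n f).
Proof.
elim: f n => //=.
- move=> t n _ [/[dup] /holds_in_witness //|/holds_notin_witness/negP tN].
  by split=> // /holds_in_witness.
- by move=> f1 IH1 f2 IH2 n /andP[q1 q2] [/IH1-> // /IH2->].
- by move=> f1 IH1 f2 IH2 n /andP[q1 q2] [/IH1-> // /IH2->].
- by move=> f1 IH1 f2 IH2 n /andP[q1 q2] [/IH1-> // /IH2->].
- by move=> f IH n qf /IH->.
Qed.

Lemma free_vars_in_witness n t i :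
  (i \in free_vars (in_witness n t)) = [|| i == n, i == n.+1 | i \in term_vars t].
Proof.
rewrite /= !(mem_cat, inE).
by case: (i == n) (i == n.+1) (i == n.+2) (i \in _) => -[] [] [].
Qed.

Lemma free_vars_notin_witness n t i : (i \in free_vars (notin_witness n t)) =
  [|| i == n, i == n.+1, i == n.+2 | i \in term_vars t].
Proof.
rewrite /= !(mem_cat, inE).
by case: (i == n) (i == n.+1) (i == n.+2) (i \in _) => -[] [] [].
Qed.

Lemma free_vars_ring_form n f i : (i < n)%N ->
  quantifier_free f -> (i \in free_vars (ring_form n f)) = (i \in free_vars f).
Proof.
elim: f n => //.
- by move=> t n i_n _; rewrite free_vars_in_witness (ltn_eqF i_n) ltn_eqF ?leqW.
- move=> f1 IH1 f2 IH2 n i_n /= /andP[q1 q2].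
  by rewrite !mem_cat IH1// IH2// ltn_addr.
- move=> f1 IH1 f2 IH2 n i_n /= /andP[q1 q2].
  by rewrite !mem_cat IH1// IH2// ltn_addr.
- move=> f1 IH1 f2 IH2 n i_n /= /andP[q1 q2].
  by rewrite !mem_cat IH1// IH2// ltn_addr.
Qed.

(** Shared bookkeeping for the binary connectives: the blocks of the two subformulas are
    adjacent. *)
Lemma mem_cat_fresh i m k1 k2 (s1 s2 v1 v2 : seq nat) :
  (i \in s1 -> i \in index_iota m (m + 3 * k1)%N \/ i \in v1) ->
  (i \in s2 -> i \in index_iota (m + 3 * k1)%N (m + 3 * k1 + 3 * k2)%N \/ i \in v2) ->
  i \in s1 ++ s2 -> i \in index_iota m (m + 3 * (k1 + k2))%N \/ i \in v1 ++ v2.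
Proof.
rewrite !mem_cat !mem_index_iota => h1 h2 /orP[/h1|/h2] [ik|->].
- by left; lia.
- by right.
- by left; lia.
- by right; rewrite orbT.
Qed.

Lemma ring_form_vars n f i : quantifier_free f ->
  i \in free_vars (ring_form n f) ->
  i \in index_iota n (n + 3 * nb_atoms f)%N \/ i \in free_vars f.
Proof.
elim: f n => //.
- by move=> t1 t2 n _; right.
- move=> t n _; rewrite free_vars_in_witness mem_index_iota.
  by case/or3P => [/eqP->|/eqP->|ti]; [left; rewrite /=; lia|left; rewrite /=; lia|right].
- by move=> f1 IH1 f2 IH2 n /andP[q1 q2]; apply: mem_cat_fresh; [apply: IH1|apply: IH2].
- by move=> f1 IH1 f2 IH2 n /andP[q1 q2]; apply: mem_cat_fresh; [apply: IH1|apply: IH2].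
- by move=> f1 IH1 f2 IH2 n /andP[q1 q2]; apply: mem_cat_fresh; [apply: IH1|apply: IH2].
Qed.

Lemma decided_vars n f i : quantifier_free f ->
  i \in free_vars (decided n f) ->
  i \in index_iota n (n + 3 * nb_atoms f)%N \/ i \in free_vars f.
Proof.
elim: f n => //.
- move=> t n _; rewrite -[X in X -> _]/(is_true (i \in free_vars (in_witness n t) ++
    free_vars (notin_witness n t))) mem_cat.
  rewrite free_vars_in_witness free_vars_notin_witness mem_index_iota.
  have [ti|_] := boolP (i \in term_vars t); first by right.
  by rewrite !orbF => i_n; left; move: i_n; do !case: eqP => ? /=; lia.
- by move=> f1 IH1 f2 IH2 n /andP[q1 q2]; apply: mem_cat_fresh; [apply: IH1|apply: IH2].
- by move=> f1 IH1 f2 IH2 n /andP[q1 q2]; apply: mem_cat_fresh; [apply: IH1|apply: IH2].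
- by move=> f1 IH1 f2 IH2 n /andP[q1 q2]; apply: mem_cat_fresh; [apply: IH1|apply: IH2].
Qed.

(** Each term has its value in [O] or outside, so witnesses of one kind exist; as the variables of
    [f] are below [n], storing them in the block leaves the values of its terms unchanged. *)
Lemma decided_witness n f e : quantifier_free f ->
  {in free_vars f, forall i, (i < n)%N} ->
  exists2 e', {in [predC index_iota n (n + 3 * nb_atoms f)%N],
    forall i, e'`_i = e`_i} & holds O e' (decided n f).
Proof.
(* [n] and [e] vary: the second subformula starts at a later block, in the environment already
   modified for the first. *)
pose ok f := forall n e, {in free_vars f, forall i, (i < n)%N} ->
  exists2 e', {in [predC index_iota n (n + 3 * nb_atoms f)%N],
    forall i, e'`_i = e`_i} & holds O e' (decided n f).
have ok2 f1 f2 m e0 : quantifier_free f1 -> ok f1 -> ok f2 ->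
    {in free_vars f1 ++ free_vars f2, forall i, (i < m)%N} ->
    exists2 e', {in [predC index_iota m (m + 3 * (nb_atoms f1 + nb_atoms f2))%N],
      forall i, e'`_i = e0`_i} &
      holds O e' (And (decided m f1) (decided (m + 3 * nb_atoms f1)%N f2)).
  move=> q1 ok_f1 ok_f2 fm.
  have f1m i : i \in free_vars f1 -> (i < m)%N.
    by move=> fi; apply: fm; rewrite mem_cat fi.
  have f2m i : i \in free_vars f2 -> (i < m + 3 * nb_atoms f1)%N.
    by move=> fi; apply/ltn_addr/fm; rewrite mem_cat fi orbT.
  have [e1 e01 d1] := ok_f1 m e0 f1m.
  have [e2 e12 d2] := ok_f2 _ e1 f2m.
  exists e2 => [i|].
    rewrite inE mem_index_iota => mi; rewrite e12 ?e01// inE mem_index_iota; lia.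
  (* The second modification begins after the block of [f1], so by [decided_vars] it cannot disturb
     the first. *)
  split=> //; have e12f : {in free_vars (decided m f1), forall i, e2`_i = e1`_i}.
    move=> i /(decided_vars q1) fi; apply: e12; rewrite inE mem_index_iota.
    by case: fi => [|/f1m]; rewrite ?mem_index_iota; lia.
  by apply/(holds_ext O e12f).
suff: quantifier_free f -> ok f by move=> /[apply]; apply.
elim: f => {n e} //.
- by move=> t1 t2 _ n e _; exists e.
- move=> t _ n e /= tn.
  have upd (c x w : R) : exists2 e' : seq R, [/\ e'`_n = c, e'`_n.+1 = x & e'`_n.+2 = w]
      & {in [predC index_iota n (n + 3)%N], forall i, e'`_i = e`_i}.
    exists (set_nth 0 (set_nth 0 (set_nth 0 e n c) n.+1 x) n.+2 w).
      by rewrite !nth_set_nth /= !nth_set_nth /= !nth_set_nth /=; split;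
        repeat case: eqP => //; lia.
    move=> i; rewrite inE mem_index_iota => ni.
    rewrite !nth_set_nth /= !nth_set_nth /= !nth_set_nth /=.
    by repeat (case: eqP => [?|_]; first lia).
  have et e' : {in [predC index_iota n (n + 3)%N], forall i, e'`_i = e`_i} ->
      GRing.eval e' t = GRing.eval e t.
    move=> ee'; apply: eval_ext => i /tn i_n.
    by apply: ee'; rewrite inE mem_index_iota; lia.
  have [tO|tO] := boolP (GRing.eval e t \in O).
    have [c [x [cq tcx]]] := (O_def _).1 tO.
    (* Membership takes two witnesses; the third place gets a default value. *)
    have [e' [e'n e'n1 _] ee'] := upd c x 0.
    by exists e' => //; left; rewrite /= (et _ ee') e'n e'n1.
  have [w wO tw] := (nO_def _).1 tO.
  have [c [x [cq wcx]]] := (O_def _).1 wO.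
  have [e' [e'n e'n1 e'n2] ee'] := upd c x w.
  by exists e' => //; right; rewrite /= (et _ ee') e'n e'n1 e'n2.
- by move=> f1 IH1 f2 IH2 /= /andP[q1 q2] n e; apply: ok2 => //; [apply: IH1|apply: IH2].
- by move=> f1 IH1 f2 IH2 /= /andP[q1 q2] n e; apply: ok2 => //; [apply: IH1|apply: IH2].
- by move=> f1 IH1 f2 IH2 /= /andP[q1 q2] n e; apply: ok2 => //; [apply: IH1|apply: IH2].
Qed.

Lemma quantifier_free_translation n f : quantifier_free f ->
  quantifier_free (ring_form n f) && quantifier_free (decided n f).
Proof.
elim: f n => //= f1 IH1 f2 IH2 n /andP[/IH1 h1 /IH2 h2];
  by case/andP: (h1 n) => -> ->; exact: h2.
Qed.

Lemma Lring_translation n f : quantifier_free f -> Lval_formula f ->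
  Lring_formula (ring_form n f) && Lring_formula (decided n f).
Proof.
elim: f n => //=.
- by move=> t1 t2 n _ ->.
- by move=> t n _ ->.
- move=> f1 IH1 f2 IH2 n /andP[q1 q2] /andP[/(IH1 n q1)/andP[-> ->]].
  by move=> /(IH2 (n + 3 * nb_atoms f1)%N q2)/andP[-> ->].
- move=> f1 IH1 f2 IH2 n /andP[q1 q2] /andP[/(IH1 n q1)/andP[-> ->]].
  by move=> /(IH2 (n + 3 * nb_atoms f1)%N q2)/andP[-> ->].
- move=> f1 IH1 f2 IH2 n /andP[q1 q2] /andP[/(IH1 n q1)/andP[-> ->]].
  by move=> /(IH2 (n + 3 * nb_atoms f1)%N q2)/andP[-> ->].
Qed.

Lemma params_in_translation C n f : quantifier_free f -> params_in C f ->
  params_in C (ring_form n f) && params_in C (decided n f).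
Proof.
elim: f n => //=.
- by move=> t1 t2 n _ ->.
- by move=> t n _ ->.
- move=> f1 IH1 f2 IH2 n /andP[q1 q2] /andP[/(IH1 n q1)/andP[-> ->]].
  by move=> /(IH2 (n + 3 * nb_atoms f1)%N q2)/andP[-> ->].
- move=> f1 IH1 f2 IH2 n /andP[q1 q2] /andP[/(IH1 n q1)/andP[-> ->]].
  by move=> /(IH2 (n + 3 * nb_atoms f1)%N q2)/andP[-> ->].
- move=> f1 IH1 f2 IH2 n /andP[q1 q2] /andP[/(IH1 n q1)/andP[-> ->]].
  by move=> /(IH2 (n + 3 * nb_atoms f1)%N q2)/andP[-> ->].
Qed.

Lemma quantifier_free_Lring_equiv f C :
  quantifier_free f -> Lval_formula f -> params_in C f ->
  exists g, [/\ Lring_formula g, existential g, params_in C g & equivalent O f g].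
Proof.
move=> qf Lf Cf; pose n := (\max_(i <- free_vars f) i).+1.
have fn i : i \in free_vars f -> (i < n)%N.
  by move=> fi; rewrite /n ltnS; apply: (leq_bigmax_seq (F := id)).
(* All witnesses are bound in front of the Boolean combination, in a block above the free variables
   of [f]; [decided] is what allows [in_witness] to stand under negations. *)
exists (exists_block n (3 * nb_atoms f)%N (And (decided n f) (ring_form n f))).
split.
- by rewrite Lring_exists_block /= andbC; apply: Lring_translation.
- by apply: existential_exists_block; rewrite /= andbC quantifier_free_translation.
- by rewrite params_in_exists_block /= andbC params_in_translation.
split=> [i|e].
  rewrite free_vars_exists_block mem_cat.
  apply/idP/andP => [fi|[/negP iN /orP[/(decided_vars qf)|/(ring_form_vars qf)] []//]].
  have i_n := fn i fi; rewrite free_vars_ring_form// fi orbT.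
  by rewrite mem_index_iota; split; first lia.
have ext e' : {in [predC index_iota n (n + 3 * nb_atoms f)%N],
    forall i, e'`_i = e`_i} -> holds O e f <-> holds O e' f.
  move=> ee'; apply: holds_ext => i /fn i_n; apply/esym/ee'.
  by rewrite inE mem_index_iota; lia.
rewrite holds_exists_block; split=> [fe|[e' ee' [de' re']]].
  have [e' ee' de'] := decided_witness e qf fn; exists e' => //; split=> //.
  by apply/(holds_ring_form qf de')/(ext _ ee').
by apply/(ext _ ee')/(holds_ring_form qf de').
Qed.

(** Only the quantifier-free matrix is translated; the induction puts the original quantifiers back
    in front of its existential translation. *)
Lemma existential_Lring_equiv f C :
  existential f -> Lval_formula f -> params_in C f ->
  exists g, [/\ Lring_formula g, existential g, params_in C g & equivalent O f g].
Proof.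
elim: f; try by move=> *; apply: quantifier_free_Lring_equiv.
move=> i f IH /= ef Lf Cf; have [g [Lg eg Cg [vg fg]]] := IH ef Lf Cf.
exists (Exists i g); split=> //; split=> [j|e] /=; first by rewrite !mem_filter vg.
by split=> -[x /fg]; exists x.
Qed.

End Syntax.

Theorem proposition3p3 (q p k : nat) (hp : prime p) (hk : (0 < k)%N)
    (hq : q = (p ^ k)%N) (F : finFieldType) (hF : #|F| = q)
    (C : divringClosed (laurent F)) (alpha : formula (laurent F)) :
  Lval_formula alpha -> existential alpha -> params_in C alpha ->
  exists beta : formula (laurent F),
    [/\ Lring_formula beta, existential beta, params_in C beta
      & equivalent (@laurent_int F) alpha beta].
Proof.
move=> La ea Ca; apply: (existential_Lring_equiv (q := #|F|)) => //.
- exact: laurent_int_def.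
- exact: laurent_nint_def.
Qed.
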